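(* There exists an infinite sequence $X=(\vec x_i)_{i=1}^\infty$ of nonzero points in $[0,1]^2$ such that $\mathrm{AlignGap}(X)\le 6$ but $\mathrm{MenuGap}(X)=\infty$.
   Context: MenuGap: Let $X=(\vec x_i)_{i=1}^N$ be an ordered sequence of nonzero points of $\mathbb{R}^k_{\ge0}$ ($N$ finite or $+\infty$), and $Q=(\vec q_i)_{i=0}^N$ an ordered sequence of points of $[0,1]^k$ with $\vec q_0=(0,\dots,0)$. Define $\mathrm{gap}_i^{X,Q}:=\min_{0\le j<i}(\vec q_i-\vec q_j)\cdot\vec x_i$ and $\mathrm{MenuGap}(X,Q):=\sum_{i=1}^N \mathrm{gap}_i^{X,Q}/\|\vec x_i\|_1$, and $\mathrm{MenuGap}(X):=\sup_Q \mathrm{MenuGap}(X,Q)$. AlignGap: For $X=(\vec x_i)_{i=1}^N$ a sequence of nonzero points in $[0,1]^k$, let $C=(c_i)_{i=0}^N$ be a sequence of reals with $c_0=0$ and $c_i\in[0,1/\|\vec x_i\|_\infty]$ for $i\ge1$; set $\vec x_0:=\vec 0$. Define $\mathrm{sgap}_i^{X,C}:=\min_{0\le j<i}\vec x_i\cdot(c_i\vec x_i-c_j\vec x_j)$, $\mathrm{AlignGap}(X,C):=\sum_{i=1}^N \max\{0,\mathrm{sgap}_i^{X,C}\}/\|\vec x_i\|_1$, and $\mathrm{AlignGap}(X):=\sup_C\mathrm{AlignGap}(X,C)$. *)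

(* Defs.v *)
From HB Require Import structures.
From mathcomp Require Import all_boot all_order all_algebra.
From mathcomp Require Import all_classical all_reals all_analysis.
Set Implicit Arguments. Unset Strict Implicit. Unset Printing Implicit Defensive.
Import Order.TTheory GRing.Theory Num.Theory.
Local Open Scope ring_scope.
Local Open Scope classical_set_scope.

Section MenuAlign.
Variables (R : realType) (k : nat).

Definition dotv (u v : 'rV[R]_k) : R := \sum_(j < k) u 0 j * v 0 j.
Definition norm1 (u : 'rV[R]_k) : R := \sum_(j < k) `|u 0 j|.
Definition normInf (u : 'rV[R]_k) : R := \big[Num.max/0]_(j < k) `|u 0 j|.
Definition in_unit_cube (u : 'rV[R]_k) : Prop := forall j, 0 <= u 0 j <= 1.
Definition nonneg_vec (u : 'rV[R]_k) : Prop := forall j, 0 <= u 0 j.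

(* Sequences X = (x_i)_{i>=1} are maps nat -> 'rV[R]_k; the value X 0 is
   ignored (in AlignGap, x_0 is the zero vector). *)

Definition menu_adm (Q : nat -> 'rV[R]_k) : Prop :=
  Q 0%N = 0 /\ forall i, in_unit_cube (Q i).

Definition menu_gap (X Q : nat -> 'rV[R]_k) (i : nat) : R :=
  \big[Num.min/dotv (Q i - Q 0%N) (X i)]_(1 <= j < i) dotv (Q i - Q j) (X i).

Definition menu_psum (X Q : nat -> 'rV[R]_k) (n : nat) : R :=
  \sum_(1 <= i < n.+1) menu_gap X Q i / norm1 (X i).

(* MenuGap(X) = sup over admissible Q of MenuGap(X,Q), where MenuGap(X,Q)
   is the (extended-real) sum of the series, taken for those Q for which
   the series converges in [-oo,+oo]. *)
Definition MenuGap (X : nat -> 'rV[R]_k) : \bar R :=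
  ereal_sup [set l : \bar R | exists Q, menu_adm Q /\
      ((fun n => (menu_psum X Q n)%:E) @ \oo --> l)].

Definition xz (X : nat -> 'rV[R]_k) (j : nat) : 'rV[R]_k :=
  if j == 0%N then 0 else X j.

Definition align_adm (X : nat -> 'rV[R]_k) (C : nat -> R) : Prop :=
  C 0%N = 0 /\ forall i, (1 <= i)%N -> 0 <= C i <= 1 / normInf (X i).

Definition align_sgap (X : nat -> 'rV[R]_k) (C : nat -> R) (i : nat) : R :=
  \big[Num.min/dotv (X i) (C i *: X i - C 0%N *: xz X 0%N)]_(1 <= j < i)
     dotv (X i) (C i *: X i - C j *: xz X j).

Definition align_term (X : nat -> 'rV[R]_k) (C : nat -> R) (i : nat) : R :=
  Num.max 0 (align_sgap X C i) / norm1 (X i).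

Definition AlignGapC (X : nat -> 'rV[R]_k) (C : nat -> R) : \bar R :=
  \sum_(1 <= i <oo) (align_term X C i)%:E.

Definition AlignGap (X : nat -> 'rV[R]_k) : \bar R :=
  ereal_sup [set AlignGapC X C | C in align_adm X].

End MenuAlign.

(* Main.v *)
Require Import Defs.
From HB Require Import structures.
From mathcomp Require Import all_boot all_order all_algebra.
From mathcomp Require Import all_classical all_reals all_analysis.
From mathcomp Require Import ring lra.
Import Order.TTheory GRing.Theory Num.Theory.
Local Open Scope ring_scope.

(** Only the direction of [x_i] matters, so take [x_i = (t_i, 1)] and let the
    slopes [t_i] run through sweeps that increase from [0].  A sweep of level
    [l] has [2^l] equally spaced slopes in [[0, 8^-l / 64]], and level [l]
    consists of the indices [32^l <= i < 32^(l+1)].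

    A menu may place the points of a sweep on a flat parabola of width [1]
    whose normals are the [x_i].  Neighbouring points of the parabola are
    [32^-l / 128] apart in the relevant direction, and raising each sweep by
    the same amount over the previous one keeps everything inside the unit
    square.  Hence [gap_i >= 32^-l / 128 >= 1 / (128 i)] and the sum diverges
    like the harmonic series.

    For aligned points [c_i x_i] with [c_i <= 1], the normalized gap of [i]
    over an earlier [j] is at most [c_i - c_j + t_i (t_i - t_j)].  Applied to
    [j] the last index with a positive gap, the first part telescopes, and the
    second is dominated by the increment of a bounded function of the index. *)

Lemma sum_ord2 (V : nmodType) (F : 'I_2 -> V) : \sum_(j < 2) F j = F 0 + F 1.
Proof.
by rewrite !big_ord_recl big_ord0 addr0; congr (F _ + F _); apply/val_inj.
Qed.

Lemma le_bigmin_nat_range (R : realDomainType) (c x0 : R) (a b : nat)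
    (F : nat -> R) :
  c <= x0 -> (forall j, (a <= j < b)%N -> c <= F j) ->
  c <= \big[Num.min/x0]_(a <= j < b) F j.
Proof.
by move=> c0 cF; rewrite big_nat_cond; apply: le_bigmin => // j /andP[/cF].
Qed.

(** * Levels and sweep lengths *)

Definition level (i : nat) : nat := trunc_log 32 i.
(** As [32 = 2 ^ 5], a positive index is at least the fifth power of its sweep length and less than
    32 times it; this is what makes gaps of order [scale ^+ 5] sum like the harmonic series. *)
Definition sweep_len (i : nat) : nat := (2 ^ level i)%N.

Lemma sweep_len_gt0 i : (0 < sweep_len i)%N.
Proof. by rewrite expn_gt0. Qed.

Lemma sweep_len_exp5 i : (sweep_len i ^ 5 = 32 ^ level i)%N.
Proof. by rewrite -expnM mulnC expnM. Qed.

Lemma sweep_len_ub i : (i < 32 * sweep_len i ^ 5)%N.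
Proof. by rewrite sweep_len_exp5 -expnS; exact: trunc_log_ltn. Qed.

Lemma sweep_len_lb {i} : (0 < i)%N -> (sweep_len i ^ 5 <= i)%N.
Proof. by move=> i0; rewrite sweep_len_exp5; exact: trunc_logP. Qed.

Lemma sweep_len_mono {j i} : (j < i)%N ->
  sweep_len j = sweep_len i \/ (2 * sweep_len j <= sweep_len i)%N.
Proof.
move=> /ltnW/(leq_trunc_log 32); rewrite leq_eqVlt => /orP[/eqP e|lt].
  by left; rewrite /sweep_len /level e.
by right; rewrite -expnS leq_exp2l.
Qed.

(** * The directions, the menu and their parameters *)

Section Construction.
Variable R : realType.

Definition scale (i : nat) : R := (sweep_len i)%:R^-1.
Definition sweep_pos (i : nat) : R := (i %% sweep_len i)%:R * scale i.
(** Sweeps are counted from index 0 as if all had the current length, so that [scale i * i] splits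
    into sweep number plus position. *)
Definition sweep_num (i : nat) : R := (i %/ sweep_len i)%:R.
Definition slope (i : nat) : R := scale i ^+ 3 * sweep_pos i / 64.

Definition dirs (i : nat) : 'rV[R]_2 := \row_j (if j == 0 then slope i else 1).

(** The last term is the parabola with normal [(slope i, 1)] at [sweep_pos i]. The [sweep_num] term
    lifts each sweep above the previous one, and [- scale i / 2] compensates for the drop of that
    lift at a new level. *)
Definition menu_height (i : nat) : R :=
  1 - scale i / 2 + scale i ^+ 5 * sweep_num i / 128
    - scale i ^+ 3 * sweep_pos i ^+ 2 / 128.

Definition menu (i : nat) : 'rV[R]_2 :=
  if i == 0%N then 0
  else \row_j (if j == 0 then sweep_pos i else menu_height i).

(* Within a level the budget grows by [scale^7 / 64^2], which is (largest
   slope) * (slope step), per index; the term [64 (1 - scale^2)] makes it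
   nondecreasing across levels. *)
Definition align_budget (i : nat) : R :=
  (64 * (1 - scale i ^+ 2) + scale i ^+ 7 * i%:R) / 64 ^+ 2.

Lemma scale_gt0 i : 0 < scale i.
Proof. by rewrite invr_gt0 ltr0n sweep_len_gt0. Qed.

Lemma scale_le1 i : scale i <= 1.
Proof. by rewrite invf_le1 ?ltr0n ?ler1n sweep_len_gt0. Qed.

Lemma mul_len_scale i : (sweep_len i)%:R * scale i = 1.
Proof. by rewrite divff // pnatr_eq0 -lt0n sweep_len_gt0. Qed.

Lemma scale_mono {j i} : (j < i)%N ->
  sweep_len j = sweep_len i \/ 2 * scale i <= scale j.
Proof.
move=> /sweep_len_mono[->|le2]; [by left|right].
have := mul_len_scale i; have := mul_len_scale j.
have := scale_gt0 i; have := scale_gt0 j.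
have : 2 * (sweep_len j)%:R <= (sweep_len i)%:R :> R by rewrite -natrM ler_nat.
move: (scale i) (scale j) (sweep_len j)%:R (sweep_len i)%:R => z z' a b hab z'0 z0 e1 e2.
have -> : 2 * z = 2 * a * (z * z') by rewrite -[LHS]mulr1 -e1; ring.
rewrite [leRHS](_ : z' = b * (z * z')); last by rewrite mulrA e2 mul1r.
by rewrite ler_pM2r // mulr_gt0.
Qed.

Lemma scale5_ub i : scale i ^+ 5 * i%:R <= 32.
Proof.
rewrite [leRHS](_ : _ = scale i ^+ 5 * (32 * sweep_len i ^ 5)%:R); last first.
  by rewrite natrM natrX mulrCA -exprMn [scale i * _]mulrC mul_len_scale expr1n mulr1.
by rewrite ler_pM2l ?exprn_gt0 ?scale_gt0 // ler_nat ltnW // sweep_len_ub.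
Qed.

Lemma scale5_lb {i} : (0 < i)%N -> 1 <= scale i ^+ 5 * i%:R.
Proof.
move=> i0; rewrite [leLHS](_ : _ = scale i ^+ 5 * (sweep_len i ^ 5)%:R); last first.
  by rewrite natrX -exprMn mulrC mul_len_scale expr1n.
by rewrite ler_pM2l ?exprn_gt0 ?scale_gt0 // ler_nat sweep_len_lb.
Qed.

Lemma sweep_pos_ge0 i : 0 <= sweep_pos i.
Proof. by rewrite mulr_ge0 // ltW ?scale_gt0. Qed.

Lemma sweep_pos_le1 i : sweep_pos i <= 1.
Proof.
rewrite -(mul_len_scale i) ler_pM2r ?scale_gt0 // ler_nat ltnW //.
by rewrite ltn_mod sweep_len_gt0.
Qed.

Lemma scale_index i : scale i * i%:R = sweep_num i + sweep_pos i.
Proof.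
rewrite {2}(divn_eq i (sweep_len i)) natrD natrM mulrDr [in RHS]/sweep_pos.
rewrite mulrCA [X in _ * X]mulrC mul_len_scale mulr1.
by congr (_ + _); rewrite mulrC.
Qed.

Lemma sweep_num_ge1 {i} : (0 < i)%N -> 1 <= sweep_num i.
Proof.
move=> i0; rewrite ler1n divn_gt0 ?sweep_len_gt0 //.
apply: leq_trans (sweep_len_lb i0); rewrite -[leqLHS]expn1.
exact: leq_pexp2l (sweep_len_gt0 i) _.
Qed.

Lemma sweep_num_ub i : scale i ^+ 5 * sweep_num i <= 32 * scale i.
Proof.
have : sweep_num i <= scale i * i%:R by rewrite scale_index lerDl sweep_pos_ge0.
move=> /(ler_wpM2l (exprn_ge0 5 (ltW (scale_gt0 i))))/le_trans; apply.
by rewrite mulrCA mulrC ler_pM2r ?scale_gt0 // scale5_ub.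
Qed.

Lemma slope_ge0 i : 0 <= slope i.
Proof. by rewrite divr_ge0 // mulr_ge0 ?exprn_ge0 ?sweep_pos_ge0 // ltW ?scale_gt0. Qed.

Lemma slope_le i : slope i <= scale i ^+ 3 / 64.
Proof.
rewrite /slope ler_pM2r ?invr_gt0 // ler_piMr ?sweep_pos_le1 //.
by rewrite exprn_ge0 // ltW ?scale_gt0.
Qed.

Lemma slope_le1 i : slope i <= 1.
Proof.
apply: (le_trans (slope_le i)).
have : scale i ^+ 3 <= 1 by rewrite exprn_ile1 ?scale_le1 // ltW ?scale_gt0.
lra.
Qed.

Lemma dotv2 (u v : 'rV[R]_2) : dotv u v = u 0 0 * v 0 0 + u 0 1 * v 0 1.
Proof. exact: sum_ord2. Qed.

Lemma norm1_dirs i : norm1 (dirs i) = slope i + 1.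
Proof. by rewrite /norm1 sum_ord2 !mxE /= normr1 ger0_norm ?slope_ge0. Qed.

Lemma normInf_dirs i : normInf (dirs i) = 1.
Proof.
rewrite /normInf !big_ord_recl big_ord0 !mxE /= normr1 ger0_norm ?slope_ge0 //.
by rewrite (max_l ler01) max_r ?slope_le1.
Qed.

Lemma dirs_neq0 i : dirs i != 0.
Proof.
apply/eqP => /matrixP/(_ 0 1); rewrite !mxE /= => /eqP.
by rewrite oner_eq0.
Qed.

Lemma dirs_in_unit_cube i : in_unit_cube (dirs i).
Proof.
move=> j; rewrite mxE; case: ifP => _; rewrite ?lexx ?ler01 //.
by rewrite slope_ge0 slope_le1.
Qed.

(** * Divergence of the menu gap *)

Lemma menu_height_bounds i : 1 / 4 <= menu_height i <= 1.
Proof.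
rewrite /menu_height; have := sweep_num_ub i; have z0 := scale_gt0 i.
have := scale_le1 i.
have : 0 <= scale i ^+ 5 * sweep_num i by rewrite mulr_ge0 ?exprn_ge0 // ltW.
have : 0 <= scale i ^+ 3 * sweep_pos i ^+ 2.
  by rewrite mulr_ge0 ?exprn_ge0 ?sweep_pos_ge0 // ltW.
have : scale i ^+ 3 * sweep_pos i ^+ 2 <= 1.
  by rewrite mulr_ile1 ?exprn_ge0 ?exprn_ile1 ?sweep_pos_ge0 ?sweep_pos_le1 ?scale_le1 // ltW.
by move=> *; apply/andP; split; lra.
Qed.

Lemma menu_admissible : menu_adm menu.
Proof.
split=> // -[|i] j; first by rewrite mxE lexx ler01.
rewrite mxE; case: ifP => _; first by rewrite sweep_pos_ge0 sweep_pos_le1.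
by have /andP[h ->] := menu_height_bounds i.+1; rewrite (le_trans _ h) //; lra.
Qed.

Lemma menu_step {j i} : (0 < j < i)%N ->
  scale i ^+ 5 / 128 <=
    (sweep_pos i - sweep_pos j) * slope i + (menu_height i - menu_height j).
Proof.
move=> /andP[j0 ij].
(* Completing the square: the parabola gives the squared distance of positions, plus a correction
   for the change of curvature between levels. *)
have -> : (sweep_pos i - sweep_pos j) * slope i + (menu_height i - menu_height j) =
    scale i ^+ 3 * (sweep_pos i - sweep_pos j) ^+ 2 / 128
    + (scale j ^+ 3 - scale i ^+ 3) * sweep_pos j ^+ 2 / 128
    + (scale j - scale i) / 2
    + (scale i ^+ 5 * sweep_num i - scale j ^+ 5 * sweep_num j) / 128.
  by rewrite /menu_height /slope; field.
have zi := scale_gt0 i; have [e|le2] := scale_mono ij.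
  have ez : scale j = scale i by rewrite /scale e.
  have -> : sweep_pos i - sweep_pos j =
      ((i %% sweep_len i)%:R - (j %% sweep_len i)%:R) * scale i.
    by rewrite /sweep_pos ez e mulrBl.
  rewrite ez !subrr !mul0r !addr0 /sweep_num e.
  set m := (i %% _)%N; set m' := (j %% _)%N; set d := (i %/ _)%N; set d' := (j %/ _)%N.
  have -> : scale i ^+ 3 * ((m%:R - m'%:R) * scale i) ^+ 2 / 128 +
     (scale i ^+ 5 * d%:R - scale i ^+ 5 * d'%:R) / 128 =
     scale i ^+ 5 / 128 * ((m%:R - m'%:R) ^+ 2 + (d%:R - d'%:R)) by field.
  rewrite ler_peMr ?divr_ge0 ?exprn_ge0 ?(ltW zi) //.
  (* Either the sweep number grows by at least 1, or the sweep is the same and the integer positions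
     differ by at least 1. *)
  have : (d' <= d)%N by rewrite leq_div2r // ltnW.
  rewrite leq_eqVlt => /orP[/eqP dd|]; last first.
    rewrite -(ler_nat R) -natr1; have := sqr_ge0 (m%:R - m'%:R : R); lra.
  have : (m' < m)%N.
    by move: ij; rewrite (divn_eq i (sweep_len i)) (divn_eq j (sweep_len i)) -/d -/d' dd ltn_add2l.
  rewrite -(ler_nat R) -natr1 dd => hm; nra.
(* At a new level [(scale j - scale i) / 2] is at least [scale j / 4], which absorbs the whole lift
   accumulated at [j]; the lift at [i] remains. *)
have := sweep_num_ub j => hj.
have : scale i ^+ 5 * 1 <= scale i ^+ 5 * sweep_num i.
  by rewrite ler_wpM2l ?exprn_ge0 ?(ltW zi) // sweep_num_ge1 // (ltn_trans j0 ij).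
have h3 : 0 <= (scale j ^+ 3 - scale i ^+ 3) * sweep_pos j ^+ 2.
  rewrite mulr_ge0 ?exprn_ge0 ?sweep_pos_ge0 // subr_ge0.
  by rewrite lerXn2r ?nnegrE ?(ltW zi) // ?ltW ?scale_gt0 //; lra.
have h4 : 0 <= scale i ^+ 3 * (sweep_pos i - sweep_pos j) ^+ 2.
  by rewrite mulr_ge0 ?sqr_ge0 // exprn_ge0 // ltW.
lra.
Qed.

Lemma menu_gap_lb {i} : (0 < i)%N -> (128 * i%:R)^-1 <= menu_gap dirs menu i.
Proof.
move=> i0; apply: (@le_trans _ _ (scale i ^+ 5 / 128)).
  have := scale5_lb i0; have : 0 < i%:R :> R by rewrite ltr0n.
  move=> ip h; rewrite invfM mulrC ler_pM2r ?invr_gt0 //.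
  by rewrite -[leLHS]mul1r ler_pdivrMr.
(* The origin, the default of the minimum, is not on a parabola; against it the height bound [1 / 4]
   suffices. *)
apply: le_bigmin_nat_range => [|j ij]; rewrite dotv2 /menu /dirs (gtn_eqF i0).
  rewrite !mxE /= !subr0 mulr1.
  have : 0 <= sweep_pos i * slope i by rewrite mulr_ge0 ?sweep_pos_ge0 ?slope_ge0.
  have : scale i ^+ 5 <= 1 by rewrite exprn_ile1 ?scale_le1 // ltW ?scale_gt0.
  have /andP[] := menu_height_bounds i; lra.
have /andP[j0 _] := ij; rewrite (gtn_eqF j0) !mxE /= mulr1.
exact: menu_step ij.
Qed.

(** The factor 2 bounds the norm [slope i + 1]. *)
Lemma menu_psum_lb n : (2 * 128)^-1 * series harmonic n <= menu_psum dirs menu n.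
Proof.
rewrite /menu_psum big_add1 /= seriesEnat mulr_sumr.
apply: ler_sum => i _; rewrite norm1_dirs /harmonic /=.
have := menu_gap_lb (ltn0Sn i); have := slope_ge0 i.+1; have := slope_le1 i.+1.
have : 0 < i.+1%:R :> R by rewrite ltr0n.
move: (slope _) (menu_gap _ _ _) (i.+1%:R) => t g x x0 t1 t0 h.
rewrite ler_pdivlMr; last lra.
apply: le_trans h; rewrite !invfM.
have : 0 < x^-1 by rewrite invr_gt0.
move: x^-1 => y y0; nra.
Qed.

Lemma MenuGap_dirs : MenuGap dirs = +oo%E.
Proof.
apply/eqP; rewrite -leye_eq; apply: ereal_sup_ubound.
exists menu; split; first exact: menu_admissible.
apply/cvgeryP/(ger_cvgy (nearW _ menu_psum_lb)).
apply: nondecreasing_dvgn_lt => [a b ab|].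
  rewrite ler_pM2l ?invr_gt0 ?mulr_gt0 //.
  exact: (nondecreasing_series (fun i _ _ => harmonic_ge0 i)).
by rewrite is_cvgMlE_tmp; [exact: dvg_harmonic|rewrite invr_eq0 mulf_neq0 ?pnatr_eq0].
Qed.

(** * Boundedness of the aligned gap *)

Lemma align_budget_ge0 i : 0 <= align_budget i.
Proof.
rewrite divr_ge0 // addr_ge0 ?mulr_ge0 ?exprn_ge0 ?(ltW (scale_gt0 i)) //.
by rewrite subr_ge0 exprn_ile1 ?scale_le1 // ltW ?scale_gt0.
Qed.

Lemma scale7_ub i : scale i ^+ 7 * i%:R <= 32 * scale i ^+ 2.
Proof.
rewrite (exprD _ 5 2) mulrAC ler_pM2r ?exprn_gt0 ?scale_gt0 //.
exact: scale5_ub.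
Qed.

Lemma scale7_lb {i} : (0 < i)%N -> scale i ^+ 2 <= scale i ^+ 7 * i%:R.
Proof.
move=> i0; rewrite (exprD _ 5 2) mulrAC -[leLHS]mul1r.
by rewrite ler_pM2r ?exprn_gt0 ?scale_gt0 // scale5_lb.
Qed.

Lemma align_budget_ub i : align_budget i <= 1.
Proof.
have := scale7_ub i; have := sqr_ge0 (scale i); rewrite /align_budget; lra.
Qed.

Lemma align_budget_step {j i} : (j < i)%N ->
  Num.max 0 (slope i * (slope i - slope j)) <= align_budget i - align_budget j.
Proof.
move=> ij; have zi := scale_gt0 i; rewrite ge_max.
have [e|le2] := scale_mono ij.
  have ez : scale j = scale i by rewrite /scale e.
  have -> : align_budget i - align_budget j =
      scale i ^+ 6 / 64 ^+ 2 * (scale i * i%:R - scale j * j%:R).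
    by rewrite /align_budget ez; field.
  have -> : slope i * (slope i - slope j) = scale i ^+ 6 / 64 ^+ 2 *
      (sweep_pos i * (sweep_pos i - sweep_pos j)).
    by rewrite /slope ez; field.
  have c0 : 0 < scale i ^+ 6 / 64 ^+ 2 by rewrite divr_gt0 ?exprn_gt0.
  have ge0 : 0 <= scale i * i%:R - scale j * j%:R.
    by rewrite ez subr_ge0 ler_pM2l // ler_nat ltnW.
  rewrite mulr_ge0 ?(ltW c0) //= ler_pM2l //; move: ge0; rewrite !scale_index.
  have : sweep_num j <= sweep_num i.
    by rewrite /sweep_num e ler_nat leq_div2r // ltnW.
  have := sweep_pos_ge0 i; have := sweep_pos_le1 i.
  move: (sweep_pos i) (sweep_pos j) (sweep_num i) (sweep_num j) => p p' d d'.
  (* If the position drops, the left side is nonpositive; otherwise [p <= 1] and the monotone sweep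
     number give the bound. *)
  move=> p1 p0 dd h; have [pp|pp] := leP p' p; nra.
have i0 : (0 < i)%N by apply: leq_ltn_trans ij.
have hi := scale7_lb i0; have hj := scale7_ub j.
(* The term [64 * (1 - scale ^+ 2)] now gains at least [48 * scale j ^+ 2], more than the at most
   [32 * scale j ^+ 2] lost with the linear term at [j]. *)
have h2 : 4 * scale i ^+ 2 <= scale j ^+ 2 by nra.
have z0 : 0 < scale i ^+ 2 by rewrite exprn_gt0.
have st : slope i * (slope i - slope j) <= scale i ^+ 2 / 64 ^+ 2.
  have := slope_le i; have := slope_ge0 i; have := slope_ge0 j.
  have : scale i ^+ 3 <= scale i.
    by rewrite exprS ler_piMr ?(ltW zi) // exprn_ile1 ?scale_le1 // ltW.
  move: (slope i) (slope j) (scale i ^+ 3) => t t' w *.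
  have : t <= scale i / 64 by lra.
  nra.
by apply/andP; rewrite /align_budget; split; lra.
Qed.

Lemma align_sgap_le (C : nat -> R) j i : C 0%N = 0 -> (j < i)%N ->
  align_sgap dirs C i <=
    (C i - C j) * (1 + slope i ^+ 2) + C j * (slope i * (slope i - slope j)).
Proof.
move=> C0 ij; rewrite [leRHS](_ : _ =
    dotv (dirs i) (C i *: dirs i - C j *: xz dirs j)); last first.
  (* For [j = 0] the vector is zero instead of [dirs 0], which is harmless because [C 0 = 0]. *)
  rewrite dotv2 /xz; case: eqP => [->|_]; rewrite !mxE /= ?C0; ring.
case: j ij => [|j] ij; last first.
  by apply: (ge_bigmin_seq _ j.+1) => //; rewrite mem_index_iota ij.
exact: bigmin_le_id.
Qed.

Lemma align_adm_bounds (C : nat -> R) i : align_adm dirs C -> 0 <= C i <= 1.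
Proof.
move=> [C0]; case: i => [_|i /(_ i.+1 isT)]; first by rewrite C0 lexx ler01.
by rewrite normInf_dirs divr1.
Qed.

Lemma align_term_le (C : nat -> R) j i : align_adm dirs C -> (j < i)%N ->
  0 < align_sgap dirs C i ->
  align_term dirs C i <= C i + align_budget i - (C j + align_budget j).
Proof.
move=> admC ij gap_gt0; rewrite /align_term max_r ?(ltW gap_gt0) // norm1_dirs.
have := align_sgap_le C j i admC.1 ij; have := align_budget_step ij; rewrite ge_max.
have /andP[] := align_adm_bounds C i admC; have /andP[] := align_adm_bounds C j admC.
have := slope_ge0 i; have := slope_le1 i.
have -> : C i + align_budget i - (C j + align_budget j) =
  C i - C j + (align_budget i - align_budget j) by ring.
move: (align_budget i - align_budget j) (slope i * (slope i - slope j)) => B s.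
move: (align_sgap _ _ _) (slope i) (C i) (C j) gap_gt0 => g t c c' g0.
move=> t1 t0 c'0 c'1 c0 c1 /andP[B0 sB] gle.
rewrite ler_pdivrMr; last lra.
have gleB : g <= (c - c' + B) * (1 + t ^+ 2).
  have : c' * s <= B by nra.
  have : 0 <= B * t ^+ 2 by rewrite mulr_ge0 ?sqr_ge0.
  lra.
have t2 : 0 < 1 + t ^+ 2 by rewrite ltr_wpDr ?sqr_ge0.
have : 0 < c - c' + B by rewrite -(pmulr_lgt0 _ t2) (lt_le_trans g0).
(* Since [0 <= t <= 1], the factor [1 + t ^+ 2] is at most the norm [t + 1]; positivity of the gap
   made the other factor positive. *)
move=> cB; apply: le_trans gleB _; rewrite ler_pM2l //; nra.
Qed.

Lemma align_term_ge0 (C : nat -> R) i : 0 <= align_term dirs C i.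
Proof. by rewrite divr_ge0 ?le_max ?lexx // norm1_dirs addr_ge0 ?slope_ge0. Qed.

(** [C] need not be monotone, so the bound is kept at the last index [j] with a positive gap (or 0):
    later terms vanish, and the next positive one telescopes from [j]. *)
Lemma align_psum_le (C : nat -> R) n : align_adm dirs C ->
  exists2 j, (j <= n)%N &
    \sum_(1 <= i < n.+1) align_term dirs C i <= C j + align_budget j.
Proof.
move=> admC; elim: n => [|n [j jn IH]].
  exists 0%N; rewrite // big_geq // admC.1 add0r.
  exact: align_budget_ge0.
rewrite big_nat_recr //=; have [gap_le0|gap_gt0] := leP (align_sgap dirs C n.+1) 0.
  exists j; first exact: leqW.
  by rewrite {2}/align_term max_l // mul0r addr0.
exists n.+1 => //.
have := align_term_le C j n.+1 admC jn gap_gt0; lra.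
Qed.

Lemma AlignGap_dirs : (AlignGap dirs <= 2%:E)%E.
Proof.
apply: ge_ereal_sup => _ [C admC <-]; apply: lime_le.
  by apply: is_cvg_nneseries => i _ _; rewrite lee_fin align_term_ge0.
apply: nearW => -[|n]; first by rewrite big_geq // lee_fin.
rewrite sumEFin lee_fin; have [j _ /le_trans] := align_psum_le C n admC; apply.
have /andP[_] := align_adm_bounds C j admC; have := align_budget_ub j; lra.
Qed.

End Construction.

Theorem theorem3p3 (R : realType) :
  exists X : nat -> 'rV[R]_2,
    (forall i, (1 <= i)%N -> X i != 0 /\ in_unit_cube (X i)) /\
    (AlignGap X <= 6%:E)%E /\
    MenuGap X = +oo%E.
Proof.
exists (dirs R); split=> [i _|].
  by split; [exact: dirs_neq0|exact: dirs_in_unit_cube].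
split; last exact: MenuGap_dirs.
by apply: le_trans (AlignGap_dirs R) _; rewrite lee_fin ler_nat.
Qed.
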